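(* Let $G$ be a connected vertex-transitive graph with $|V(G)|\geq 3$. Then every path of length at most $4$ in $G$ closes to a cycle. Moreover, for every integer $\ell\geq 5$ there exist infinitely many connected vertex-transitive graphs each containing a path of length $\ell$ that does not close to any cycle.
   Context: All graphs are finite, simple and undirected, and graphs are considered up to isomorphism. A path of length $\ell$ (an $\ell$-edge path) in $G$ is a sequence $(x_0,\dots,x_\ell)$ of pairwise distinct vertices with $x_i x_{i+1}\in E(G)$ for $0\le i\le \ell-1$; a path of length $0$ is a single vertex. A cycle is a sequence $(x_0,\dots,x_{\ell-1},x_\ell=x_0)$ with $\ell\ge 3$, $x_0,\dots,x_{\ell-1}$ pairwise distinct and $x_ix_{i+1}\in E(G)$ for all $0\le i\le \ell-1$. Paths and cycles are identified with the subgraphs formed by their vertices and edges. A path $P$ closes to a cycle if there is a cycle $C$ in $G$ such that $P$ is a subgraph of $C$. A graph is vertex-transitive if its automorphism group acts transitively on its vertices. *)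

(* Defs.v *)
From HB Require Import structures.
From mathcomp Require Import all_boot all_fingroup.

Set Implicit Arguments.
Unset Strict Implicit.
Unset Printing Implicit Defensive.

Record sgraph := SGraph {
  vertex :> finType;
  adj : rel vertex;
  adj_sym : symmetric adj;
  adj_irrefl : irreflexive adj
}.

Definition isomorphic (G H : sgraph) : Prop :=
  exists2 f : G -> H, bijective f & forall x y, adj (f x) (f y) = adj x y.

Definition connected (G : sgraph) : Prop := forall x y : G, connect (@adj G) x y.

Definition Aut_graph (G : sgraph) : {set {perm G}} :=
  [set s : {perm G} | [forall x, forall y, adj (s x) (s y) == adj x y]].

Lemma Aut_graphP (G : sgraph) (s : {perm G}) :
  reflect (forall x y, adj (s x) (s y) = adj x y) (s \in Aut_graph G).
Proof.
rewrite inE; apply: (iffP forallP) => [sP x y | sP x].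
  by have /forallP/(_ y)/eqP := sP x.
by apply/forallP => y; rewrite sP.
Qed.

Lemma Aut_graph_group_set (G : sgraph) : group_set (Aut_graph G).
Proof.
apply/group_setP; split=> [|s t /Aut_graphP sP /Aut_graphP tP].
  by apply/Aut_graphP => x y; rewrite !perm1.
by apply/Aut_graphP => x y; rewrite !permM tP sP.
Qed.

Canonical Aut_graph_group (G : sgraph) := Group (Aut_graph_group_set G).

Definition vertex_transitive (G : sgraph) : bool :=
  [transitive Aut_graph G, on [set: G] | 'P].

Definition is_path (G : sgraph) (l : nat) (p : seq G) : Prop :=
  [/\ size p = l.+1, uniq p & sorted (@adj G) p].

(* The cycle (x_0, ..., x_{l-1}, x_l = x_0) is represented by                 *)
(* [:: x_0; ...; x_{l-1}], without repeating its initial vertex.              *)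
Definition is_cycle (G : sgraph) (c : seq G) : Prop :=
  [/\ 3 <= size c, uniq c & path.cycle (@adj G) c].

Definition vertices (G : sgraph) (s : seq G) : {set G} := [set x in s].

Definition path_edges (G : sgraph) (p : seq G) : {set {set G}} :=
  [set:: [seq [set u.1; u.2] | u <- zip p (behead p)]].

Definition cycle_edges (G : sgraph) (c : seq G) : {set {set G}} :=
  [set:: [seq [set u.1; u.2] | u <- zip c (rot 1 c)]].

Definition closes_to_cycle (G : sgraph) (p : seq G) : Prop :=
  exists c : seq G,
    [/\ is_cycle c, vertices p \subset vertices c
      & path_edges p \subset cycle_edges c].

(* Graphs are counted up to isomorphism.                                      *)
Definition infinitely_many_graphs (P : sgraph -> Prop) : Prop :=
  exists F : nat -> sgraph,
    (forall i, P (F i)) /\ (forall i j, i <> j -> ~ isomorphic (F i) (F j)).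

(* Main.v *)
Require Import Defs.
From mathcomp Require Import all_boot all_fingroup.
From mathcomp Require Import zify.

Set Implicit Arguments.
Unset Strict Implicit.
Unset Printing Implicit Defensive.

(* Write [bdry A] for the set of vertices outside A with a neighbour in A.  Among
   the sets A such that A and the complement of A :|: bdry A are nonempty, those
   with a boundary of minimal size k, and then of minimal cardinality, are the
   atoms.  By submodularity an atom lies in F, in bdry F, or in the rest, for each
   F with a boundary of size k.  In a connected vertex-transitive graph of valency
   d the atoms cover all vertices, so the boundary of an atom A contains at least
   two disjoint atoms, and k >= 2 #|A|; as d + 1 <= #|A| + k, this gives
   2 (d + 1) <= 3 k.  If a path of length l with 2 <= l <= 4 does not close, the
   component of one end in the complement of its interior has a boundary inside
   this interior, which contradicts the bound or the valency.

   For l >= 5, take the square of a long cycle Z/n: the path 0, -2, -1, 1, 2, 3,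
   ..., l - 2 contains all neighbours of 0 among its interior vertices, so that a
   cycle through it would have degree 3 at one of them. *)

(** * Boundaries and separating sets *)

Definition bdry (G : sgraph) (A : {set G}) : {set G} :=
  [set y | (y \notin A) && [exists x in A, adj x y]].

Definition far (G : sgraph) (A : {set G}) : {set G} := ~: (A :|: bdry A).

Definition separating (G : sgraph) (A : {set G}) : bool :=
  (A != set0) && (far A != set0).

Lemma bdryP (G : sgraph) (A : {set G}) y :
  reflect (y \notin A /\ exists2 x, x \in A & adj x y) (y \in bdry A).
Proof.
rewrite inE; apply: (iffP andP) => [[yA /existsP[x /andP[]]]|[yA [x xA xy]]].
  by split=> //; exists x.
by split=> //; apply/existsP; exists x; rewrite xA.
Qed.

Lemma in_far (G : sgraph) (A : {set G}) y :
  (y \in far A) = (y \notin A) && (y \notin bdry A).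
Proof. by rewrite inE in_setU negb_or. Qed.

Lemma far_adj (G : sgraph) (A : {set G}) x y :
  x \in far A -> y \in A -> adj x y = false.
Proof.
rewrite in_far => /andP[xA /bdryP xN] yA; apply/negP => xy; apply: xN.
by split=> //; exists y => //; rewrite adj_sym.
Qed.

Lemma bdry_far (G : sgraph) (A : {set G}) : bdry (far A) \subset bdry A.
Proof.
apply/subsetP => y /bdryP[]; rewrite in_far negb_and !negbK.
case: (boolP (y \in A)) => //= yA _ [x xF xy].
by rewrite (far_adj xF yA) in xy.
Qed.

Lemma sub_far_far (G : sgraph) (A : {set G}) : A \subset far (far A).
Proof.
apply/subsetP => x xA; rewrite !in_far xA /=; apply/bdryP => -[_ [y yF yx]].
by rewrite (far_adj yF xA) in yx.
Qed.

Lemma separating_far (G : sgraph) (A : {set G}) :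
  separating A -> separating (far A).
Proof.
case/andP=> A0 F0; rewrite /separating F0 /=.
have /set0Pn[x xA] := A0; apply/set0Pn; exists x.
exact: subsetP (sub_far_far A) x xA.
Qed.

Lemma card_trichotomy (G : sgraph) (A X : {set G}) :
  #|X| = #|X :&: A| + #|X :&: bdry A| + #|X :&: far A|.
Proof.
rewrite -(cardsID (A :|: bdry A) X) -setDE; congr (_ + _).
rewrite setIUr cardsU [X in _ - X](_ : _ = 0) ?subn0 //.
apply/eqP; rewrite cards_eq0; apply/eqP/setP=> y; rewrite !inE.
by case: (y \in A); rewrite /= ?andbF.
Qed.

(** A vertex with a neighbour in [A :&: F] lies in [A] or [bdry A], and in [F] or [bdry F]. Adding
    this bound to the one for [far A] and [far F] yields submodularity. *)
Lemma bdry_setI (G : sgraph) (A F : {set G}) :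
  bdry (A :&: F) \subset (A :&: bdry F) :|: (bdry A :&: bdry F) :|: (bdry A :&: F).
Proof.
apply/subsetP => y /bdryP[yAF [x /setIP[xA xF] xy]]; rewrite !in_setU !in_setI.
have nbE (B : {set G}) : x \in B -> (y \in bdry B) = (y \notin B).
  by move=> xB; apply/bdryP/idP => [[]|yB] //; split=> //; exists x.
by rewrite !nbE //; move: yAF; rewrite in_setI; do 2!case: (y \in _).
Qed.

Lemma far_setI (G : sgraph) (A F : {set G}) : far A \subset far (A :&: F).
Proof.
apply/subsetP=> x xA; rewrite in_far in_setI negb_and.
have := xA; rewrite in_far => /andP[-> _] /=; apply/bdryP=> -[_ [y /setIP[yA _]]].
by rewrite adj_sym (far_adj xA).
Qed.

Lemma separatingI (G : sgraph) (A F : {set G}) :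
  separating A -> A :&: F != set0 -> separating (A :&: F).
Proof.
case/andP=> _ /set0Pn[x xA] AF; rewrite /separating AF; apply/set0Pn; exists x.
exact: subsetP (far_setI A F) x xA.
Qed.

(** * Fragments and atoms *)

(** Here [k] is a free parameter; that it is a lower bound for all boundaries is supplied separately
    by [kmin]. *)
Definition fragment (G : sgraph) (k : nat) (F : {set G}) : Prop :=
  separating F /\ #|bdry F| = k.

Definition atom (G : sgraph) (k : nat) (A : {set G}) : Prop :=
  fragment k A /\ forall F : {set G}, fragment k F -> #|A| <= #|F|.

Section Atoms.
Context (G : sgraph) (k : nat).
Hypothesis kmin : forall F : {set G}, separating F -> k <= #|bdry F|.

(** One inclusion is [bdry_far]; the minimality of [k] turns it into an equality. *)
Lemma bdry_far_fragment (F : {set G}) : fragment k F -> bdry (far F) = bdry F.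
Proof.
case=> sF kF; apply/eqP; rewrite eqEcard bdry_far kF kmin //.
exact: separating_far.
Qed.

Lemma fragment_far (F : {set G}) : fragment k F -> fragment k (far F).
Proof.
move=> fF; split; last by rewrite (bdry_far_fragment fF); case: fF.
by apply: separating_far; case: fF.
Qed.

(** Otherwise [A :&: F] is separating and smaller than the atom [A], so its boundary exceeds [k];
    counting over the nine intersections of [A], [bdry A], [far A] with [F], [bdry F], [far F] then
    gives a contradiction. *)
Lemma atom_subset (A F : {set G}) :
  atom k A -> fragment k F -> A :&: F != set0 -> A \subset F.
Proof.
move=> [fA Amin] fF AF; apply/setIidPl/eqP/negPn/negP => ne.
have [[sA kA] [sF kF]] := (fA, fF).
have lt : #|A :&: F| < #|A| by rewrite proper_card // properEneq ne subsetIl.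
have sAF := separatingI sA AF.
have bAF : k < #|bdry (A :&: F)|.
  rewrite ltn_neqAle kmin // andbT; apply: contraTN lt => /eqP kAF.
  by rewrite -leqNgt; apply: Amin; split.
have cUU (X Y Z : {set G}) : #|X :|: Y :|: Z| <= #|X| + #|Y| + #|Z|.
  by rewrite (leq_trans (leq_card_setU _ _)) // leq_add2r leq_card_setU.
have b1 := leq_trans (subset_leq_card (bdry_setI A F)) (cUU _ _ _).
have b2 := leq_trans (subset_leq_card (bdry_setI (far A) (far F))) (cUU _ _ _).
rewrite !bdry_far_fragment // in b2.
have e1 := card_trichotomy F (bdry A); have e2 := card_trichotomy A (bdry F).
have e3 := card_trichotomy F A; have e4 := card_trichotomy A (far F).
have a0 : 0 < #|A :&: F| by rewrite card_gt0.
have a1 := Amin _ (fragment_far fF).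
rewrite !(setIC (bdry F)) !(setIC (far F)) in e2 e4.
(* If the two far sides are disjoint, [#|A| <= #|far F|] bounds [A :&: bdry F] by
   [bdry A :&: far F], against [bAF]. Otherwise their intersection is separating, and the two
   boundaries sum to more than 2k, against [b1] and [b2]. *)
case: (eqVneq (far A :&: far F) set0) => [E|ne2].
  by rewrite E cards0 in e4; lia.
have := kmin (separatingI (separating_far sA) ne2).
lia.
Qed.

(** A vertex of [A] outside [bdry F] lies in one of the fragments [F] and [far F], which would then
    contain all of [A]. *)
Lemma atom_sub_bdry (A F : {set G}) :
  atom k A -> fragment k F -> A :&: bdry F != set0 -> A \subset bdry F.
Proof.
move=> aA fF /set0Pn[x /setIP[xA xF]]; apply/subsetP=> y yA.
apply: contraT => yN; have [yF|yF] := boolP (y \in F).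
  have /subsetP/(_ x xA) : A \subset F.
    by apply: atom_subset => //; apply/set0Pn; exists y; rewrite in_setI yA.
  by move: xF => /bdryP[/negPf->].
have /subsetP/(_ x xA) : A \subset far F.
  apply: atom_subset => //; first exact: fragment_far.
  by apply/set0Pn; exists y; rewrite in_setI yA in_far yF.
by rewrite in_far xF andbF.
Qed.

End Atoms.

(** * Neighbourhoods and the action of automorphisms *)

Definition nbhd (G : sgraph) (x : G) : {set G} := [set y | adj x y].

Lemma connected_bdry_neq0 (G : sgraph) (A : {set G}) :
  connected G -> separating A -> bdry A != set0.
Proof.
move=> Gconn /andP[/set0Pn[x xA] /set0Pn[y yF]]; apply/negP => /eqP N0.
have clA : closed (@adj G) A.
  apply: (intro_closed (sym_connect_sym (@adj_sym G))) => u v uv uA.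
  apply: contraT => vA; have : v \in bdry A by apply/bdryP; split=> //; exists u.
  by rewrite N0 inE.
have yA : y \in A by rewrite -(closed_connect clA (Gconn x y)).
by move: yF; rewrite in_far yA.
Qed.

Lemma vertex_transitiveP (G : sgraph) (x y : G) :
  vertex_transitive G -> exists2 s : {perm G}, s \in Aut_graph G & s x = y.
Proof.
move=> Gt; have [s sA ->] := atransP2 Gt (in_setT x) (in_setT y).
by exists s.
Qed.

Section Automorphism.
Context (G : sgraph) (s : {perm G}).
Hypothesis sAut : s \in Aut_graph G.

Lemma nbhd_aut (x : G) : nbhd (s x) = s @: nbhd x.
Proof.
apply/setP => y; rewrite -[y](permKV s) mem_imset; last exact: perm_inj.
by rewrite !inE (Aut_graphP _ sAut).
Qed.

Lemma bdry_aut (A : {set G}) : bdry (s @: A) = s @: bdry A.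
Proof.
apply/setP => y; rewrite -[y](permKV s) mem_imset; last exact: perm_inj.
apply/bdryP/bdryP; rewrite mem_imset; try exact: perm_inj.
  move=> [yA [_ /imsetP[x xA ->]]]; rewrite (Aut_graphP _ sAut) => xy.
  by split=> //; exists x.
move=> [yA [x xA xy]]; split=> //.
by exists (s x); rewrite ?imset_f // (Aut_graphP _ sAut).
Qed.

Lemma far_aut (A : {set G}) : far (s @: A) = s @: far A.
Proof.
apply/setP => y; rewrite -[y](permKV s) mem_imset; last exact: perm_inj.
by rewrite !in_far bdry_aut !mem_imset //; exact: perm_inj.
Qed.

Lemma atom_aut (k : nat) (A : {set G}) : atom k A -> atom k (s @: A).
Proof.
have sI := @perm_inj _ s; move=> [[/andP[A0 F0] kA] Amin].
split; last by rewrite card_imset.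
by rewrite /fragment /separating far_aut bdry_aut !imset_eq0 A0 F0 card_imset.
Qed.
End Automorphism.

Lemma card_nbhd_transitive (G : sgraph) (x y : G) :
  vertex_transitive G -> #|nbhd x| = #|nbhd y|.
Proof.
move=> /(vertex_transitiveP x y)[s sA <-].
by rewrite nbhd_aut // card_imset //; exact: perm_inj.
Qed.

(** * Existence of atoms and the connectivity bound *)

Lemma exists_atom (G : sgraph) (F : {set G}) : separating F ->
  exists2 k, forall E : {set G}, separating E -> k <= #|bdry E|
           & exists A : {set G}, atom k A.
Proof.
move=> sF; case: (arg_minnP (fun E : {set G} => #|bdry E|) sF) => K sK Kmin.
exists #|bdry K| => //.
pose P (E : {set G}) := separating E && (#|bdry E| == #|bdry K|).
have PK : P K by rewrite /P sK eqxx.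
case: (arg_minnP (fun E : {set G} => #|E|) PK) => A /andP[sA /eqP kA] Amin.
by exists A; split=> // E [sE kE]; apply: Amin; rewrite /P sE kE eqxx.
Qed.

Lemma atom_double (G : sgraph) (k : nat) (A : {set G}) :
  connected G -> vertex_transitive G ->
  (forall E : {set G}, separating E -> k <= #|bdry E|) ->
  atom k A -> 2 * #|A| <= k.
Proof.
move=> Gc Gt kmin aA; have [[sA kA] Amin] := aA.
have /andP[/set0Pn[x xA] F0] := sA.
have cover y : y \in bdry A ->
    exists B : {set G}, [/\ atom k B, y \in B, B \subset bdry A & #|B| = #|A|].
  move=> yN; have [s sAut sx] := vertex_transitiveP x y Gt.
  have aB := atom_aut sAut aA; have yB : y \in s @: A by rewrite -sx imset_f.
  exists (s @: A); split=> //; last by rewrite card_imset //; exact: perm_inj.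
  apply: (atom_sub_bdry kmin) => //.
  by apply/set0Pn; exists y; rewrite in_setI yB.
have /set0Pn[y yN] := connected_bdry_neq0 Gc sA.
have [B [aB yB BN cB]] := cover y yN.
have [NB|[z zN zB]] : bdry A = B \/ exists2 z, z \in bdry A & z \notin B.
  have [NB|/subsetPn] := boolP (bdry A \subset B); last by right.
  by left; apply/eqP; rewrite eqEsubset BN NB.
  (* If [bdry A] were a single atom [B], then [A] and [far A], both with boundary [B], would both
     meet [bdry B]; but [bdry B] is [A] by cardinality. *)
  have nbB (u : G) : u \in B ->
      forall E : {set G}, bdry E = B -> E :&: bdry B != set0.
    move=> uB E EB; have /bdryP[_ [v vE vu]] : u \in bdry E by rewrite EB.
    apply/set0Pn; exists v; rewrite in_setI vE; apply/bdryP; split.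
      by apply/negP; rewrite -EB => /bdryP[]; rewrite vE.
    by exists u; rewrite // adj_sym.
  have AB : A \subset bdry B.
    apply: (atom_sub_bdry kmin) => //; last exact: nbB yB _ NB.
    by case: aB.
  have EAB : A = bdry B.
    apply/eqP; rewrite eqEcard AB; case: aB => -[_ ->] _.
    by rewrite -kA NB cB leqnn.
  have fA : fragment k A by case: aA.
  have /set0Pn[v /setIP[vF]] : far A :&: bdry B != set0.
    by apply: nbB yB _ _; rewrite (bdry_far_fragment kmin).
  by rewrite -EAB; move: vF; rewrite in_far => /andP[/negPf->].
have [C [aC zC CN cC]] := cover z zN.
have BC : [disjoint C & B].
  rewrite -setI_eq0; apply: contraNT zB => CB.
  suff /subsetP -> : C \subset B by [].
  by apply: (atom_subset kmin) => //; case: aB.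
have : #|C :|: B| <= k by rewrite -kA subset_leq_card // subUset CN.
by rewrite cardsU disjoint_setI0 // cards0 cB cC subn0 mul2n addnn.
Qed.

(* Mader and Watkins: the connectivity of a connected vertex-transitive graph
   of valency d is at least 2(d+1)/3. *)
Lemma connectivity_bound (G : sgraph) (F : {set G}) (x : G) :
  connected G -> vertex_transitive G -> separating F ->
  2 * #|nbhd x|.+1 <= 3 * #|bdry F|.
Proof.
move=> Gc Gt sF; have [k kmin [A aA]] := exists_atom sF.
have dA := atom_double Gc Gt kmin aA.
have [[/andP[/set0Pn[y yA] _] kA] _] := aA.
have sub : y |: nbhd y \subset A :|: bdry A.
  apply/subsetP => z /setU1P[->|]; rewrite !in_setU ?yA // inE => yz.
  by case: (boolP (z \in A)) => //= zA; apply/bdryP; split=> //; exists y.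
have := leq_trans (subset_leq_card sub) (leq_card_setU _ _).
rewrite cardsU1 inE adj_irrefl /= (card_nbhd_transitive y x Gt) kA.
by have := kmin F sF; lia.
Qed.

(** * Closing a path to a cycle *)

Lemma prefix_zip_cat (S T : eqType) (s s' : seq S) (t t' : seq T) :
  prefix (zip s t) (zip (s ++ s') (t ++ t')).
Proof.
by elim: s t => [|a s IH] [|b t] //=; rewrite ?prefix0s // eqxx IH.
Qed.

Lemma path_edges_sub_cycle (G : sgraph) (x : G) (q r : seq G) :
  path_edges (x :: q) \subset cycle_edges (x :: q ++ r).
Proof.
apply/subsetP => e; rewrite !inE rot1_cons -cats1 -catA.
have /prefixP[s E] := prefix_zip_cat (x :: q) r q (r ++ [:: x]).
by move=> eE; rewrite -cat_cons E map_cat mem_cat eE.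
Qed.

Lemma closes_to_cycle_behead (G : sgraph) (z x : G) (q : seq G) :
  closes_to_cycle [:: z, x & q] -> closes_to_cycle (x :: q).
Proof.
move=> [c [cc /subsetP vs /subsetP es]]; exists c; split=> //.
  by apply/subsetP=> u; rewrite inE => uq; apply: vs; rewrite inE in_cons uq orbT.
by apply/subsetP=> u; rewrite inE => uq; apply: es; rewrite inE in_cons uq orbT.
Qed.

(** A walk from [y] back to [x] outside [I] shortens to a simple path, whose interior [r] completes
    the cycle. A nonempty [I] ensures at least three vertices. *)
Lemma closes_to_cycle_connect (G : sgraph) (x y : G) (I : seq G) :
  I != [::] -> uniq (x :: rcons I y) -> path (@adj G) x (rcons I y) ->
  connect [rel u v | adj u v && (v \notin I)] y x ->
  closes_to_cycle (x :: rcons I y).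
Proof.
move=> I0 Iu Ip /connectP[s0 /shortenP[s sp su _] {s0} xs].
case/lastP: s => [|r z] in sp su xs *.
  by rewrite xs /= mem_rcons inE eqxx in Iu.
rewrite last_rcons in xs; rewrite -{}xs in sp su.
have [rp rI] : path (@adj G) y (rcons r x) /\ all [predC I] (rcons r x).
  move: sp; move: (rcons r x) (y) => t.
  by elim: t => //= v t IH u /andP[/andP[-> vI] /IH[-> ->]]; rewrite vI.
exists (x :: rcons I y ++ r); split; last exact: path_edges_sub_cycle.
  split.
  - by case: I I0 {Iu Ip sp rI} => // a I _; rewrite /= size_cat size_rcons.
  - rewrite -cat_cons cat_uniq Iu /=; move: su rI.
    rewrite -!rcons_cons rcons_uniq /= all_rcons inE negb_or.
    move=> /andP[/andP[xy xr] /andP[yr ->]] /andP[xI rI]; rewrite andbT.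
    apply/hasPn=> u ur; rewrite inE mem_rcons inE !negb_or.
    rewrite (memPn xr) // (memPn yr) //=; exact: (allP rI).
  by rewrite /= rcons_cat cat_path Ip last_rcons.
by apply/subsetP=> u; rewrite !in_set -cat_cons mem_cat => ->.
Qed.

(** * Paths of length at most 4 *)

Lemma size_le_card_nbhd (G : sgraph) (z : G) (s : seq G) :
  uniq s -> all (@adj G z) s -> size s <= #|nbhd z|.
Proof.
move=> /card_uniqP <- /allP sz; apply: subset_leq_card; apply/subsetP => u us.
by rewrite inE sz.
Qed.

(** If [[set x]] separates, its boundary has at most d vertices and 2(d + 1) <= 3d; otherwise [x]
    and its neighbours exhaust the graph. *)
Lemma card_nbhd_ge2 (G : sgraph) (x : G) :
  connected G -> vertex_transitive G -> 3 <= #|G| -> 1 < #|nbhd x|.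
Proof.
move=> Gc Gt G3; have nx : bdry [set x] \subset nbhd x.
  by apply/subsetP=> y /bdryP[_ [z /set1P->]]; rewrite inE.
have le := subset_leq_card nx.
case: (boolP (separating [set x])) => [sx|].
  by have := connectivity_bound x Gc Gt sx; lia.
rewrite /separating -card_gt0 cards1 /= negbK => /eqP F0.
have := cardsC ([set x] :|: bdry [set x]); rewrite -/(far _) F0 cards0 addn0.
by have [] := leq_card_setU [set x] (bdry [set x]); rewrite cards1; lia.
Qed.

(* C is the component of y in the complement of I.  Valency 4 or more contradicts
   [connectivity_bound] outright.  In valency 2, only the last vertex of I can be
   adjacent to C.  In valency 3, the bound forces bdry C = I = [:: a; b; c], and b
   has neighbours in C and in far C besides a and c. *)
Lemma short_path_closes (G : sgraph) (x y : G) (I : seq G) :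
  connected G -> vertex_transitive G -> 3 <= #|G| ->
  0 < size I <= 3 -> uniq (x :: rcons I y) -> path (@adj G) x (rcons I y) ->
  closes_to_cycle (x :: rcons I y).
Proof.
move=> Gc Gt G3 /andP[I0 I3] Iu Ip.
have {}I0 : I != [::] by rewrite -size_eq0 -lt0n.
apply: closes_to_cycle_connect => //; set e' := [rel u v | _].
apply: contraT => nyx; pose C := [set z | connect e' y z].
have yC : y \in C by rewrite inE connect0.
have xC : x \notin C by rewrite inE.
have /and4P[xIy yI uI _] : [&& x \notin rcons I y, y \notin I, uniq I & true].
  by move: Iu; rewrite /= rcons_uniq => /and3P[-> -> ->].
have xI : x \notin I by move: xIy; rewrite mem_rcons inE negb_or => /andP[].
have CI u : u \in C -> u \notin I.
  rewrite inE => /connectP[p]; elim/last_ind: p => [_ -> //|p z _].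
  by rewrite rcons_path last_rcons => /andP[_ /andP[_ zI]] ->.
have nbI z : z \in bdry C -> z \in I.
  case/bdryP=> zC [u uC uz]; apply: contraNT zC => zI.
  move: uC; rewrite !inE => /connect_trans -> //.
  by apply: connect1; rewrite /e' /= uz.
have xF : x \in far C by rewrite in_far xC; apply: contra xI; exact: nbI.
have sC : separating C by apply/andP; split; apply/set0Pn; [exists y | exists x].
have d2 z := card_nbhd_ge2 z Gc Gt G3.
have dE z : #|nbhd z| = #|nbhd x| := card_nbhd_transitive z x Gt.
have bC := connectivity_bound x Gc Gt sC.
have bF := connectivity_bound x Gc Gt (separating_far sC).
have nb_le (s : seq G) : {subset bdry C <= s} -> #|bdry C| <= size s.
  move=> ss; apply: leq_trans (card_size s); apply: subset_leq_card.
  exact/subsetP.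
have third z u v : z \in bdry C -> u != v -> u \notin C -> v \notin C ->
    adj z u -> adj z v -> 3 <= #|nbhd x|.
  case/bdryP=> zC [w wC wz] uv uC vC zu zv; rewrite -(dE z).
  apply: (@size_le_card_nbhd _ z [:: w; u; v]); last by rewrite /= zu zv adj_sym wz.
  rewrite /= !inE uv negb_or !andbT.
  by apply/andP; split; apply: contraTneq wC => ->.
have bI := nb_le I nbI; have {d2}dx := d2 x.
clearbody C; clear nyx e' I0 yI uI xIy.
case: I => [|a [|b [|c [|? ?]]]] // in I3 Iu Ip xI CI nbI bI *.
- by rewrite /= in bI; clear -dx bC bI; lia.
- by rewrite /= in bI; clear -dx bC bI; lia.
(* Two interior vertices force valency 2. The neighbours of [a] are then [x] and [b], both outside
   [C], so [bdry C] is at most [b], which is too small. *)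
- move: Ip Iu; rewrite /= !inE !negb_or => /and4P[xa ab _ _].
  move=> /andP[/and3P[_ xb _] _].
  have aC : a \notin bdry C.
    apply/negP=> aN; have: 3 <= #|nbhd x|; last by rewrite /= in bI; clear -bC bI; lia.
    apply: (third a x b) => //; last by rewrite adj_sym.
    by apply/negP=> /CI; rewrite !inE eqxx orbT.
  suff: {subset bdry C <= [:: b]} by move=> /nb_le /=; clear -dx bC; lia.
  move=> z zN; have := nbI _ zN; rewrite !inE => /orP[/eqP za|] //.
  by rewrite -za zN in aC.
move: Ip Iu; rewrite /= !inE !negb_or => /and5P[xa ab bc cy _].
move=> /and4P[/and4P[_ xb _ _] /and3P[_ ac _] /andP[_ _] _].
have [aC bC' cC] : [/\ a \notin C, b \notin C & c \notin C].
  by split; apply/negP=> /CI; rewrite !inE eqxx ?orbT.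
rewrite /= in bI; have [d2|d3] : #|nbhd x| = 2 \/ #|nbhd x| = 3.
  by clear -dx bC bI; lia.
  have aN : a \notin bdry C.
    apply/negP=> aN; have: 3 <= #|nbhd x|; last by rewrite d2.
    by apply: (third a x b) => //; rewrite adj_sym.
  have bN : b \notin bdry C.
    apply/negP=> bN; have: 3 <= #|nbhd x|; last by rewrite d2.
    by apply: (third b a c) => //; rewrite adj_sym.
  suff: {subset bdry C <= [:: c]} by move=> /nb_le /=; clear -dx bC; lia.
  move=> z zN; have := nbI _ zN; rewrite !inE => /or3P[/eqP za|/eqP zb|] //.
    by rewrite -za zN in aN.
  by rewrite -zb zN in bN.
have eqN : bdry C = [set z in [:: a; b; c]].
  apply/eqP; rewrite eqEcard; apply/andP; split.
    by apply/subsetP=> z /nbI; rewrite inE.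
  by rewrite cardsE (leq_trans (card_size _)) //=; clear -bC d3; lia.
(* The bound for [far C] gives its boundary at least three vertices too. *)
have eqF : bdry (far C) = bdry C.
  by apply/eqP; rewrite eqEcard bdry_far; clear -bF bI d3; lia.
have mN z : z \in [:: a; b; c] -> z \in bdry C by rewrite eqN in_set.
have bN : b \in bdry C by apply: mN; rewrite !inE eqxx orbT.
have /bdryP[_ [u uC ub]] := bN.
have /bdryP[_ [v vF vb]] : b \in bdry (far C) by rewrite eqF.
have [vC vN] : v \notin C /\ v \notin bdry C by apply/andP; rewrite -in_far.
suff: 4 <= #|nbhd b| by rewrite dE d3.
apply: (@size_le_card_nbhd _ b [:: u; v; a; c]); last first.
  by rewrite /= bc -[adj b a]adj_sym ab -[adj b u]adj_sym ub -[adj b v]adj_sym vb.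
rewrite /= !inE !negb_or ac !andbT.
have neN z w : z \notin bdry C -> w \in [:: a; b; c] -> z != w.
  by move=> zN /mN; apply: contraTneq => <-.
have uN : u \notin bdry C by apply/negP=> /nbI; apply/negP/CI.
have [aM cM] : a \in [:: a; b; c] /\ c \in [:: a; b; c].
  by rewrite !inE !eqxx !orbT.
rewrite (neN u a) // (neN u c) // (neN v a) // (neN v c) // !andbT.
by apply: contraNneq vC => <-.
Qed.

(** Lengths 2 to 4 leave one to three interior vertices. A shorter path is first extended at its
    start to length 2, since every vertex has two neighbours. *)
Lemma path_closes_le4 (G : sgraph) (l : nat) (p : seq G) :
  connected G -> vertex_transitive G -> 3 <= #|G| -> l <= 4 ->
  is_path l p -> closes_to_cycle p.
Proof.
move=> Gc Gt G3 l4 [].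
have long q : 3 <= size q <= 5 -> uniq q -> sorted (@adj G) q -> closes_to_cycle q.
  case: q => [|x q] //; case/lastP: q => [|I y] //=.
  by rewrite size_rcons => sI qu qp; apply: short_path_closes.
have ext x (y : G) : exists2 z, adj z x & z != y.
  have /card_gt1P[u [v [ux vx uv]]] := card_nbhd_ge2 x Gc Gt G3.
  rewrite !inE in ux vx; case: (eqVneq u y) => [uy|uy]; last first.
    by exists u; rewrite // adj_sym.
  by exists v; rewrite ?[adj v x]adj_sym // -uy eq_sym.
case: p => [|x [|y [|z q]]] //= sp pu ps.
- have [y yx xy] := ext x x; have [z zy zx] := ext y x.
  do 2!apply: closes_to_cycle_behead; apply: (long [:: z; y; x]) => //=.
    by rewrite !inE negb_or zx xy !andbT; apply: contraTneq zy => ->; rewrite adj_irrefl.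
  by rewrite zy yx.
- have [z zx zy] := ext x y; apply: closes_to_cycle_behead.
  apply: (long [:: z; x; y]) => //=; last by rewrite zx.
  move: pu; rewrite /= !inE negb_or zy !andbT => ->; rewrite andbT.
  by apply: contraTneq zx => ->; rewrite adj_irrefl.
by apply: long => //=; case: sp => ->; lia.
Qed.

(** * An obstruction to closing *)

Lemma next_zip_rot1 (T : eqType) (c : seq T) (u v : T) :
  uniq c -> (u, v) \in zip c (rot 1 c) -> v = next c u.
Proof.
case: c => [|y p] // cu /(nthP (u, v))[i].
rewrite size_zip size_rot minnn => ic; rewrite nth_zip ?size_rot // => -[Eu Ev].
(* [next_nth] gives the successor as [nth y p i]; at the last index the default value [y], the head
   of the cycle, is returned. *)
rewrite next_nth -{1}Eu mem_nth // -Eu index_uniq // -Ev rot1_cons.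
rewrite nth_rcons; case: (ltngtP i (size p)) => [ip|pi|->].
- exact: set_nth_default.
- by rewrite /= in ic; lia.
by rewrite nth_default.
Qed.

Lemma cycle_edge_next (G : sgraph) (c : seq G) (a b : G) :
  uniq c -> [set a; b] \in cycle_edges c -> b = next c a \/ b = prev c a.
Proof.
move=> cu; rewrite inE => /mapP[[u v] uv /= E].
have vE := next_zip_rot1 cu uv; have uE : u = prev c v by rewrite vE prev_next.
have : (a \in [set u; v]) && (b \in [set u; v]) by rewrite -E !inE !eqxx orbT.
have : (u \in [set a; b]) && (v \in [set a; b]) by rewrite E !inE !eqxx orbT.
rewrite !inE => /andP[ua va] /andP[/orP[]/eqP Ea /orP[]/eqP Eb]; subst a b.
- by left; move: va; rewrite orbb -vE => /eqP ->.
- by left.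
- by right.
by right; move: ua; rewrite orbb -uE => /eqP ->.
Qed.

(** On a cycle through the path, [x2], [x3] and [x4] already have both their cycle neighbours on the
    path, neither being [x0]. So [x1] is both successor and predecessor of [x0], which leaves no
    place for [x2]. *)
Lemma enclosed_end_not_closes (G : sgraph) (x0 x1 x2 x3 x4 x5 : G) (q : seq G) :
  uniq [:: x0, x1, x2, x3, x4, x5 & q] ->
  (forall y, adj x0 y -> y \in [:: x1; x2; x3; x4]) ->
  ~ closes_to_cycle [:: x0, x1, x2, x3, x4, x5 & q].
Proof.
set p := [:: x0, _ & _] => pu N [c [[_ cu cc] /subsetP vs /subsetP es]].
have x0c : x0 \in c by have := vs x0; rewrite !inE eqxx => ->.
pose cn a b := b = next c a \/ b = prev c a.
have cnS a b : cn a b -> cn b a.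
  by case=> ->; [right; rewrite prev_next | left; rewrite next_prev].
have deg2 z a b d :
    a != b -> b != d -> a != d -> cn z a -> cn z b -> cn z d -> False.
  move=> /eqP ab /eqP bd /eqP ad; rewrite /cn.
  by do 3!case=> ?; congruence.
have pe a b : [set a; b] \in path_edges p -> cn a b.
  by move=> /es; exact: cycle_edge_next.
have e01 : cn x0 x1 by apply: pe; rewrite inE /= !in_cons eqxx ?orbT.
have e12 : cn x1 x2 by apply: pe; rewrite inE /= !in_cons eqxx ?orbT.
have e23 : cn x2 x3 by apply: pe; rewrite inE /= !in_cons eqxx ?orbT.
have e34 : cn x3 x4 by apply: pe; rewrite inE /= !in_cons eqxx ?orbT.
have e45 : cn x4 x5 by apply: pe; rewrite inE /= !in_cons eqxx ?orbT.
move: pu; rewrite /p /= !inE !negb_or -!andbA.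
move=> /and5P[n01 n02 n03 n04 /and5P[n05 _ n12 n13 /and5P[n14 n15 _ n23]]].
move=> /and5P[n24 n25 _ n34 /and4P[n35 _ n45 _]].
have only w : cn x0 w -> w = x1.
  move=> cw; have : w \in [:: x1; x2; x3; x4].
    apply: N; case: cw => ->; first exact: next_cycle.
    by rewrite adj_sym; apply: prev_cycle.
  rewrite !inE => /or4P[] /eqP wE //; case: notF; rewrite wE in cw.
  - by case: (deg2 x2 x0 x1 x3) => //; exact: cnS.
  - by case: (deg2 x3 x0 x2 x4) => //; exact: cnS.
  by case: (deg2 x4 x0 x3 x5) => //; exact: cnS.
have nE : next c x0 = x1 by apply: only; left.
have pE : prev c x0 = x1 by apply: only; right.
case: e12 => E; case/eqP: n02; rewrite E.
  by rewrite -pE next_prev.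
by rewrite -nE prev_next.
Qed.

(** * Squares of cycles *)

(* For i, j < n this says i - j = +-1 or +-2 modulo n: the subtractions are
   truncated, so their sum is the absolute difference. *)
Definition circ_dist (n i j : nat) : bool :=
  (i - j) + (j - i) \in [:: 1; 2; n - 1; n - 2].

Section SquareOfCycle.
Context (m : nat).
Local Notation n := (m + 5).+1.

Definition circ_adj : rel 'I_n := [rel i j : 'I_n | circ_dist n i j].

Lemma circ_adj_sym : symmetric circ_adj.
Proof. by move=> i j; rewrite /circ_adj /= /circ_dist addnC. Qed.

Lemma circ_adj_irrefl : irreflexive circ_adj.
Proof. by move=> i; rewrite /circ_adj /= /circ_dist !inE; lia. Qed.

Definition sq_cycle : sgraph := SGraph circ_adj_sym circ_adj_irrefl.

Lemma sq_cycle_connected : connected sq_cycle.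
Proof.
have from0 k : k < n -> connect circ_adj ord0 (inord k).
  elim: k => [|k IH] kn.
    by rewrite (_ : inord 0 = ord0) //; apply/val_inj; rewrite /= inordK.
  apply: (connect_trans (IH (ltnW kn))); apply: connect1.
  by rewrite /circ_adj /= /circ_dist !inordK // ?inE; lia.
move=> x y; apply: (@connect_trans _ _ (ord0 : 'I_n)).
  rewrite (sym_connect_sym circ_adj_sym) -(inord_val (x : 'I_n)).
  exact/from0/ltn_ord.
by rewrite -(inord_val (y : 'I_n)); exact/from0/ltn_ord.
Qed.

(** Rotation of Z/n by [k]; a conditional subtraction instead of a remainder keeps later goals in
    linear arithmetic. *)
Definition shift (k i : 'I_n) : 'I_n :=
  inord (if i + k < n then i + k else i + k - n).

Lemma shiftE (k i : 'I_n) :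
  shift k i = (if i + k < n then i + k else i + k - n) :> nat.
Proof.
rewrite /shift inordK //; have := ltn_ord i; have := ltn_ord k.
by case: ifP; lia.
Qed.

Lemma shift_inj (k : 'I_n) : injective (shift k).
Proof.
move=> i j /(congr1 (@nat_of_ord n)); rewrite !shiftE => E; apply/val_inj.
by move: E (ltn_ord i) (ltn_ord j) (ltn_ord k) => /=; do 2!case: ifP; lia.
Qed.

Lemma shift_adj (k i j : 'I_n) : circ_adj (shift k i) (shift k j) = circ_adj i j.
Proof.
rewrite /circ_adj /= /circ_dist !shiftE !inE.
have := ltn_ord i; have := ltn_ord j; have := ltn_ord k.
by case: ifP; case: ifP; lia.
Qed.

Lemma sq_cycle_transitive : vertex_transitive sq_cycle.
Proof.
apply/imsetP; exists (ord0 : 'I_n) => //; apply/esym/setP => k; rewrite inE.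
apply/orbitP; exists (perm (@shift_inj k)).
  by apply/Aut_graphP => i j; rewrite !permE; exact: shift_adj.
rewrite /= apermE permE; apply: (@ord_inj n).
by rewrite shiftE /= add0n ltn_ord.
Qed.
End SquareOfCycle.

Lemma sq_cycle_path (m l : nat) : 5 <= l <= m ->
  exists2 p : seq (sq_cycle m), is_path l p & ~ closes_to_cycle p.
Proof.
move=> /andP[l5 lm].
(* With n = m + 6, [m + 4] and [m + 5] stand for -2 and -1; the run ends at l - 2, below [m + 4]
   because l <= m. *)
pose s := [:: 0, m + 4, m + 5, 1, 2, 3 & iota 4 (l - 5)].
pose v (k : nat) : 'I_(m + 5).+1 := inord k.
have sn : all (fun k => k < (m + 5).+1) s.
  by apply/allP=> k; rewrite !inE mem_iota; lia.
have vE : [seq nat_of_ord i | i <- map v s] = s.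
  by rewrite -map_comp -[RHS]map_id; apply/eq_in_map => k /(allP sn) kn; exact: inordK.
have vu : uniq (map v s).
  rewrite -(map_inj_uniq (@ord_inj (m + 5).+1)) vE.
  rewrite /s /= iota_uniq !inE !mem_iota; lia.
exists (map v s).
  split=> //; first by rewrite size_map /= size_iota; lia.
  have -> : sorted (@adj (sq_cycle m)) (map v s) =
      sorted (circ_dist (m + 5).+1) [seq nat_of_ord i | i <- map v s].
    by rewrite sorted_map.
  have run k j : path (circ_dist (m + 5).+1) j (iota j.+1 k).
    by elim: k j => //= k IH j; rewrite IH andbT /circ_dist subSnn !inE; lia.
  by rewrite vE /s /= run andbT /circ_dist !inE; clear; lia.
apply: enclosed_end_not_closes => //= y.
have := ltn_ord (y : 'I_(m + 5).+1).
by rewrite /circ_adj /= /circ_dist !inE -!val_eqE /= !inordK //; clear; lia.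
Qed.

Theorem theorem1p6 :
  (forall G : sgraph, connected G -> vertex_transitive G -> 3 <= #|G| ->
     forall (l : nat) (p : seq G), l <= 4 -> is_path l p -> closes_to_cycle p)
  /\
  (forall l : nat, 5 <= l ->
     infinitely_many_graphs (fun G : sgraph =>
       [/\ connected G, vertex_transitive G
         & exists2 p : seq G, is_path l p & ~ closes_to_cycle p])).
Proof.
split=> [G Gc Gt G3 l p l4 pp | l l5]; first exact: path_closes_le4 pp.
(* The offset [l] makes room for the path; distinct indices give different numbers of vertices. *)
exists (fun i => sq_cycle (l + i)); split=> [i | i j ij].
  split; [exact: sq_cycle_connected | exact: sq_cycle_transitive |].
  by apply: sq_cycle_path; rewrite l5 leq_addr.
move=> [f fb _]; apply: ij; have := bij_eq_card fb; rewrite !card_ord; lia.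
Qed.
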